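(* For all integers $c$, $p$ and $k$ with $c\geq 1$, $p\geq 2(8+c)^{c+1}-1$ and $k=p-c$, we have $g^k_{k-1}(p)=p+1$.
   Context: A Gallai-$k$-coloring of the complete graph $K_n$ is a map from $E(K_n)$ to $\{1,\dots,k\}$ (not necessarily surjective) with no rainbow triangle, i.e. every triangle receives at most two distinct colors. For integers $k\ge 1$ and $1\le q\le \binom{p}{2}$, $g^k_q(p)$ denotes the smallest positive integer $n$ such that every Gallai-$k$-coloring of $K_n$ contains a copy of $K_p$ whose edges receive at most $q$ distinct colors. *)

(* Defs.v *)
From mathcomp Require Import all_boot.

Set Implicit Arguments.
Unset Strict Implicit.
Unset Printing Implicit Defensive.

Definition edge (n : nat) : finType := {e : {set 'I_n} | #|e| == 2}.

Definition coloring (n k : nat) : finType := {ffun edge n -> 'I_k}.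

Definition colors_on (n k : nat) (chi : coloring n k) (S : {set 'I_n}) :
    {set 'I_k} :=
  [set chi e | e : edge n & val e \subset S].

Definition gallai (n k : nat) (chi : coloring n k) : Prop :=
  forall T : {set 'I_n}, #|T| = 3 -> #|colors_on chi T| <= 2.

(* A copy of K_p in K_n is determined by its set of p vertices. *)
Definition forces (k q p n : nat) : Prop :=
  forall chi : coloring n k, gallai chi ->
    exists S : {set 'I_n}, #|S| = p /\ #|colors_on chi S| <= q.

(* The graph of the partial function g^k_q(p): [is_g k q p n] means that
   g^k_q(p) exists and equals n. *)
Definition is_g (k q p n : nat) : Prop :=
  [/\ 0 < n, forces k q p n & forall m : nat, 0 < m -> forces k q p m -> n <= m].

(* Main.v *)
Require Import Defs.
From mathcomp Require Import all_boot.
From mathcomp Require Import zify.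

(** Deleting one vertex from a Gallai coloring destroys at most one color: two
    colors living only on edges at [v], say on [va] and [vb], would leave no
    color for [ab].  Hence [m >= 1] vertices carry at most [m - 1] colors
    ([card_colors_on_gallai]).

    For the upper bound, put [n = p + 1], so that [k = n - 1 - c], and suppose
    that every set of [p] vertices sees all [k] colors.  Then no color dies when
    a single vertex is deleted.  If a set [I] of more than [c] vertices could be
    deleted without killing any color, the remaining [n - #|I|] vertices would
    carry [n - 1 - c] colors, which is too many.  To find [I], attach to each
    color a set [W] of at most six vertices such that the color survives the
    deletion of any set meeting [W] at most once ([robust_color_witness]).  The
    graph joining two vertices that lie in a common [W] has average degree at
    most 36, because there are fewer than [n] colors, so it has an independent
    set of size at least [n / 146] ([large_independent_set]), and the
    hypothesis on [p] makes this larger than [c].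

    For the lower bound, color an edge of [K_p] by its larger endpoint,
    identifying the largest values so that exactly [k] colors remain.  This
    coloring is Gallai and all [k <= p - 1] colors occur, so the only copy of
    [K_p] has [k] colors; complete graphs on fewer vertices contain no [K_p]. *)

Set Implicit Arguments.
Unset Strict Implicit.
Unset Printing Implicit Defensive.

(** * Gallai colorings have few colors *)

Lemma mem_colors_on n k (chi : coloring n k) (S : {set 'I_n}) (e : edge n) :
  val e \subset S -> chi e \in colors_on chi S.
Proof. by move=> eS; apply/imsetP; exists e; rewrite ?inE. Qed.

Lemma colors_onS n k (chi : coloring n k) (S T : {set 'I_n}) :
  S \subset T -> colors_on chi S \subset colors_on chi T.
Proof.
move=> sST; apply/subsetP => i /imsetP[e]; rewrite inE => eS ->.
by apply/mem_colors_on/(subset_trans eS).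
Qed.

Lemma edge_endpoint n (e : edge n) (v : 'I_n) :
  v \in val e -> exists2 a, a != v & val e = [set v; a].
Proof.
case/cards2P: (valP e) => x [y [nxy ->]]; rewrite !inE => /orP[] /eqP->.
  by exists y; rewrite 1?eq_sym.
by exists x; rewrite // setUC.
Qed.

(** Two lost colors [i] on [va] and [j] on [vb] would make [vab] rainbow: the
    color of [ab] survives, so it is neither [i] nor [j]. *)
Lemma card_colors_lost_at_vertex n k (chi : coloring n k) (S : {set 'I_n}) v :
  gallai chi ->
  #|colors_on chi S :\: colors_on chi (S :\ v)| <= 1.
Proof.
move=> gchi; rewrite leqNgt; apply/negP => /card_gt1P[i [j [Hi Hj nij]]].
have edgeP l : l \in colors_on chi S :\: colors_on chi (S :\ v) ->
    exists a, exists2 e : edge n,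
      chi e = l & [/\ a != v, a \in S, v \in S & val e = [set v; a]].
  rewrite inE => /andP[lost /imsetP[e]]; rewrite inE => eS le.
  have ve : v \in val e.
    apply: contraNT lost => nve; rewrite le; apply: mem_colors_on.
    by rewrite subsetD1 eS.
  have [a nav ea] := edge_endpoint ve.
  exists a, e => //; move: eS; rewrite ea subUset !sub1set => /andP[vS aS].
  by split.
have [a [e ei [nav aS vS ea]]] := edgeP _ Hi.
have [b [f fj [nbv bS _ fb]]] := edgeP _ Hj.
have nab : a != b.
  apply: contraNneq nij => eab; rewrite -ei -fj.
  by apply/eqP; congr (chi _); apply: val_inj; rewrite ea fb eab.
have cab : #|[set a; b]| == 2 by rewrite cards2 nab.
pose g : edge n := exist _ [set a; b] cab.
have gS : chi g \in colors_on chi (S :\ v).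
  apply: mem_colors_on; rewrite subUset !sub1set !inE nav nbv aS.
  by rewrite bS.
have cT : #|[set v; a; b]| = 3.
  by rewrite setUC cardsU1 cards2 !inE negb_or nbv (eq_sym b) nab eq_sym nav.
have /negP[] : ~~ (2 < #|colors_on chi [set v; a; b]|).
  by rewrite -leqNgt; apply: gchi.
have notg l : l \in colors_on chi S :\: colors_on chi (S :\ v) -> l != chi g.
  by rewrite inE => /andP[+ _]; apply: contraNneq => ->.
have <- : #|[set chi g; i; j]| = 3.
  rewrite -setUA cardsU1 cards2 nij !inE negb_or.
  by rewrite eq_sym notg // eq_sym notg.
apply: subset_leq_card; rewrite !subUset !sub1set -ei -fj.
by rewrite !mem_colors_on ?ea ?fb //=; apply/subsetP => x;
  rewrite !inE => /orP[] ->; rewrite ?orbT.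
Qed.

Lemma card_colors_on_gallai n k (chi : coloring n k) (S : {set 'I_n}) :
  gallai chi -> #|colors_on chi S| <= #|S|.-1.
Proof.
move=> gchi; move: {2}#|S| (erefl #|S|) => m; elim: m S => [|m IH] S cS.
- rewrite cS leqn0 cards_eq0; apply/eqP/setP => i; rewrite inE.
  apply/imsetP => -[e]; rewrite inE => /subset_leq_card.
  by rewrite cS (eqP (valP e)).
- have [v vS] : exists v, v \in S by apply/card_gt0P; rewrite cS.
  have cSv : #|S :\ v| = m by move: cS; rewrite (cardsD1 v) vS => -[].
  have := IH _ cSv; have := card_colors_lost_at_vertex S v gchi.
  rewrite cardsD (setIidPr (colors_onS chi (subD1set S v))) cS cSv.
  case: m cSv {IH cS} => [|m] cSv; last by lia.
  move=> _ _; rewrite leqn0 cards_eq0; apply/eqP/setP => i; rewrite inE.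
  apply/imsetP => -[e]; rewrite inE => /subset_leq_card.
  by rewrite (cardsD1 v S) vS cSv (eqP (valP e)).
Qed.

(** * Deleting many vertices without losing a color *)

Lemma card_bigcup_leq_sum (J T : finType) (P : pred J) (F : J -> {set T}) :
  #|\bigcup_(i | P i) F i| <= \sum_(i | P i) #|F i|.
Proof.
elim/big_ind2: _ => [|A m B m' le_Am le_Bm'|//]; first by rewrite cards0.
by apply: leq_trans (leq_add le_Am le_Bm'); apply: leq_card_setU.
Qed.

(** A weak form of Turan's theorem: if [d] bounds the average degree, at least
    half of the vertices have degree at most [2 * d], and a maximal independent
    set among those dominates them. *)
Lemma large_independent_set (T : finType) (e : rel T) (d : nat) :
  symmetric e -> \sum_x #|[set y | e x y]| <= d * #|T| ->
  exists2 I : {set T},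
    {in I &, forall x y, x != y -> ~~ e x y} & #|T| <= 2 * (2 * d + 1) * #|I|.
Proof.
move=> esym sum_deg; pose deg x := #|[set y | e x y]|.
pose L := [set x | deg x <= 2 * d].
pose indep (A : {set T}) :=
  (A \subset L) && [forall x in A, forall y in A, (x != y) ==> ~~ e x y].
have [I /maxsetP[/andP[sIL /forall_inP indI] maxI] _] :
    {I | maxset indep I & set0 \subset I}.
  apply: maxset_exists; rewrite /indep sub0set.
  by apply/forall_inP => x; rewrite inE.
have indI' : {in I &, forall x y, x != y -> ~~ e x y}.
  by move=> x y xI yI; apply/implyP; have /forall_inP := indI x xI; apply.
exists I => //.
have few_high : (2 * d + 1) * #|~: L| <= d * #|T|.
  apply: leq_trans sum_deg; rewrite mulnC -sum_nat_const.
  rewrite [leqRHS](bigID (mem (~: L))) /=; apply: leq_trans (leq_addr _ _).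
  by apply: leq_sum => x; rewrite !inE -ltnNge addn1.
have dominated : L \subset \bigcup_(x in I) (x |: [set y | e x y]).
  apply/subsetP => y yL; apply/bigcupP.
  have [yI|nyI] := boolP (y \in I); first by exists y; rewrite ?setU11.
  case: (boolP [exists x in I, e x y]) => [/exists_inP[x xI exy]|].
    by exists x; rewrite // !inE exy orbT.
  rewrite negb_exists_in => /forall_inP noe.
  (* otherwise y could be added to the maximal set I *)
  have : y |: I = I; last by move=> eI; rewrite -eI setU11 in nyI.
  apply: maxI (subsetUr _ _); rewrite /indep subUset sub1set yL sIL /=.
  apply/forall_inP => u uI; apply/forall_inP => w wI; apply/implyP.
  move: uI wI; rewrite !inE => /predU1P[->|uI] /predU1P[->|wI].
  - by rewrite eqxx.
  - by rewrite esym noe.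
  - by rewrite noe.
  - exact: indI'.
have card_L : #|L| <= #|I| * (2 * d + 1).
  apply: leq_trans (subset_leq_card dominated) _.
  apply: leq_trans (card_bigcup_leq_sum _ _) _.
  rewrite -sum_nat_const; apply: leq_sum => x /(subsetP sIL).
  by rewrite inE cardsU1 /deg; case: (_ \notin _) => /=; lia.
have := cardsC L; nia.
Qed.

(** Take an edge [ab] of the color, one that avoids [a] and one that avoids
    [b].  A set with at most one vertex in their union either misses [ab], or
    meets the union only in one end of [ab] and so misses the corresponding
    other edge. *)
Lemma robust_color_witness n k (chi : coloring n k) (i : 'I_k) (v0 : 'I_n) :
  (forall v, i \in colors_on chi [set~ v]) ->
  exists2 W : {set 'I_n}, #|W| <= 6 &
    forall I : {set 'I_n}, #|I :&: W| <= 1 -> i \in colors_on chi (~: I).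
Proof.
move=> robust.
have avoid v : exists2 e : edge n, v \notin val e & i = chi e.
  have /imsetP[e] := robust v; rewrite inE => ev ie; exists e => //.
  by apply/negP => /(subsetP ev); rewrite !inE eqxx.
have [e _ ie] := avoid v0.
case/cards2P: (valP e) => a [b [nab eab]].
have [f naf jf] := avoid a; have [g nbg jg] := avoid b.
exists (val e :|: val f :|: val g).
  have ce := eqP (valP e); have cf := eqP (valP f); have cg := eqP (valP g).
  have := (leq_card_setU (val e :|: val f) (val g)).1.
  have := (leq_card_setU (val e) (val f)).1.
  by rewrite ce cf cg; lia.
move=> I /card_le1_eqP uniqI.
have single x h : x \in I -> x \in val e -> i = chi h -> x \notin val h ->
    val h \subset val e :|: val f :|: val g -> i \in colors_on chi (~: I).
  move=> xI xe ih nxh /subsetP hW; rewrite ih; apply: mem_colors_on.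
  apply/subsetP => y yh; rewrite inE; apply: contra nxh => yI.
  suff -> : x = y by [].
  apply: uniqI; rewrite in_setI; first by rewrite yI hW.
  by rewrite xI !in_setU xe.
have [aI|naI] := boolP (a \in I).
  apply: (single a f) => //; first by rewrite eab set21.
  by rewrite -setUA setUCA subsetUl.
have [bI|nbI] := boolP (b \in I).
  by apply: (single b g) => //; rewrite ?subsetUr // eab set22.
rewrite ie; apply: mem_colors_on.
by rewrite eab subUset !sub1set !inE naI.
Qed.

Lemma robust_deletion_set n k (chi : coloring n k) :
  0 < n -> k <= n -> (forall i v, i \in colors_on chi [set~ v]) ->
  exists2 I : {set 'I_n}, colors_on chi (~: I) = setT & n <= 146 * #|I|.
Proof.
case: n chi => // n chi _ le_kn robust.
have /fin_all_exists2[W cW WP] i :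
    exists2 W : {set 'I_n.+1}, #|W| <= 6 &
      forall I : {set 'I_n.+1}, #|I :&: W| <= 1 -> i \in colors_on chi (~: I).
  exact: robust_color_witness ord0 (robust i).
pose e x y := [exists i, (x \in W i) && (y \in W i)].
have esym : symmetric e.
  by move=> x y; apply: eq_existsb => i; rewrite andbC.
(* each color contributes at most 6 ^ 2 = 36 ordered pairs, loops included, and
   146 = 2 * (2 * 36 + 1) *)
have sum_deg : \sum_x #|[set y | e x y]| <= 36 * #|'I_n.+1|.
  apply: (@leq_trans (\sum_x \sum_(i | x \in W i) #|W i|)).
    apply: leq_sum => x _.
    apply: (@leq_trans #|\bigcup_(i | x \in W i) W i|).
      apply/subset_leq_card/subsetP => y; rewrite inE.
      by case/existsP => i /andP[xi yi]; apply/bigcupP; exists i.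
    exact: card_bigcup_leq_sum.
  rewrite (exchange_big_dep xpredT) //= card_ord.
  apply: (@leq_trans (\sum_(i < k) 36)); last first.
    by rewrite sum_nat_const card_ord; lia.
  by apply: leq_sum => i _; rewrite sum_nat_const (leq_mul (cW i) (cW i)).
have [I indI cI] := large_independent_set esym sum_deg.
exists I; last by move: cI; rewrite card_ord.
apply/setP => i; rewrite in_setT; apply: WP.
apply/card_le1_eqP => x y; rewrite !in_setI => /andP[xI xW] /andP[yI yW].
apply/eqP; apply: contraT => nyx; have /negP[] := indI y x yI xI nyx.
by apply/existsP; exists i; rewrite yW.
Qed.

(** * The upper bound *)

Lemma robust_gallai_order_bound n k (chi : coloring n k) :
  0 < k -> gallai chi -> (forall i v, i \in colors_on chi [set~ v]) ->
  n <= 146 * (n - 1 - k).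
Proof.
move=> k_gt0 gchi robust.
have [n0|n_gt0] := posnP n; first by rewrite {1}n0.
have le_kn : k <= n.-1.
  have := card_colors_on_gallai setT gchi; rewrite cardsT card_ord.
  suff -> : colors_on chi setT = setT by rewrite cardsT card_ord.
  apply/setP => i; rewrite in_setT.
  exact: subsetP (colors_onS chi (subsetT _)) _ (robust i (Ordinal n_gt0)).
have [|I colI cI] := robust_deletion_set n_gt0 _ robust; first by lia.
have := card_colors_on_gallai (~: I) gchi.
have := cardsC I; rewrite colI cardsT !card_ord; lia.
Qed.

Lemma forces_succ k p :
  0 < k -> 146 * (p - k) <= p -> forces k (k - 1) p (p + 1).
Proof.
move=> k_gt0 hp chi gchi; rewrite addn1 in chi gchi *.
case: (boolP [forall i, forall v, i \in colors_on chi [set~ v]]).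
  move/forallP => robust.
  have := robust_gallai_order_bound k_gt0 gchi (fun i => elimT forallP (robust i)).
  lia.
case/forallPn => i /forallPn[v lost]; exists [set~ v].
split; first by rewrite cardsC1 card_ord.
have : #|colors_on chi [set~ v]| < #|'I_k|.
  by rewrite -cardsT; apply/proper_card/properP; split => //; exists i.
by rewrite card_ord; lia.
Qed.

(** * The lower bound *)

(** Color an edge by its larger endpoint, shifted by one and truncated.  In a
    triangle the two edges at the largest vertex get the same color. *)
Lemma gallai_coloring_all_colors n k :
  0 < k ->
  exists2 chi : coloring n k, gallai chi &
    k < n -> colors_on chi setT = setT.
Proof.
case: k => // k _.
pose top (A : {set 'I_n}) := \max_(i in A) (i : nat).
pose col (A : {set 'I_n}) : 'I_k.+1 := inord (minn (top A).-1 k).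
exists [ffun e => col (val e)].
- move=> T cT.
  have T0 : 0 < #|T| by rewrite cT.
  have [w wT topT] := eq_bigmax_cond (fun i : 'I_n => i : nat) T0.
  have cTw : #|T :\ w| = 2 by move: cT; rewrite (cardsD1 w) wT => -[].
  apply: (@leq_trans #|[set col T; col (T :\ w)]|); last first.
    by rewrite cards2; case: (_ != _).
  apply/subset_leq_card/subsetP => i /imsetP[e]; rewrite inE => eT ->.
  rewrite ffunE !inE; have [we|nwe] := boolP (w \in val e).
    suff et : top (val e) = top T by rewrite /col et eqxx.
    apply/eqP; rewrite eqn_leq; apply/andP; split.
      by apply/bigmax_leqP => x xe; apply: leq_bigmax_cond (subsetP eT x xe).
    rewrite {1}/top topT.
    by apply: (@leq_bigmax_cond _ (mem (val e)) (fun i : 'I_n => i : nat)).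
  suff -> : val e = T :\ w by rewrite eqxx orbT.
  by apply/eqP; rewrite eqEcard subsetD1 eT nwe cTw (eqP (valP e)).
- move=> lt_kn; apply/setP => i; rewrite in_setT.
  have lt_in := ltn_ord i.
  have i1 : i.+1 < n by lia.
  have i0 : i < n by lia.
  pose x := Ordinal i0; pose y := Ordinal i1.
  have nxy : x != y by rewrite -val_eqE /= neq_ltn leqnn.
  have cxy : #|[set x; y]| == 2 by rewrite cards2 nxy.
  have -> : i = [ffun e : edge n => col (val e)] (exist _ [set x; y] cxy).
    rewrite ffunE; apply: val_inj; rewrite /= /col /top.
    rewrite big_setU1 ?inE //= big_set1 /=.
    by rewrite inordK; lia.
  by apply: mem_colors_on.
Qed.

Lemma forces_order_gt k p m :
  0 < k -> k < p -> forces k (k - 1) p m -> p < m.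
Proof.
move=> k_gt0 lt_kp forcing; rewrite ltnNge; apply/negP => le_mp.
have [chi gchi all_col] := gallai_coloring_all_colors m k_gt0.
have [S [cS]] := forcing chi gchi.
have le_pm : p <= m by have := max_card (mem S); rewrite card_ord cS.
have -> : S = setT by apply/eqP; rewrite eqEcard subsetT cardsT card_ord cS.
by rewrite all_col ?cardsT ?card_ord; lia.
Qed.

(** Only a bound linear in [c] is extracted from the exponential one: for [c = 1] it gives
    [p >= 161], and for larger [c] the cube of [8 + c] already suffices. *)
Lemma deficiency_bound c p :
  1 <= c -> 2 * (8 + c) ^ (c + 1) - 1 <= p -> 146 * c <= p.
Proof.
move=> c_gt0; apply: leq_trans.
have [->|c_neq1] := eqVneq c 1; first by [].
have : (8 + c) ^ 3 <= (8 + c) ^ (c + 1) by rewrite leq_pexp2l; lia.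
by rewrite !expnS expn0; nia.
Qed.

Theorem theorem1p13 (c p k : nat) (hc : 1 <= c)
    (hp : 2 * (8 + c) ^ (c + 1) - 1 <= p) (hk : k = p - c) :
  is_g k (k - 1) p (p + 1).
Proof.
have le_cp := deficiency_bound hc hp.
split; first by rewrite addn1.
- by apply: forces_succ; lia.
- by move=> m _ forcing; rewrite addn1; apply: forces_order_gt forcing; lia.
Qed.
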